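(* Let $\rho\in(0,2]$, let all costs satisfy $c_x>1$, and let $\mathcal{G}$ be any guessing strategy for $X$ whose induced weights $q_1,\dots,q_{M'}$, $M'=\sum_{i=1}^M\lceil c_i\rceil$, satisfy both $$q_{k+1}^{\frac1\rho}\le\frac1k\left(q_1^{\frac1\rho}+\dots+q_k^{\frac1\rho}\right)\quad\text{and}\quad q_{k+1}^{\frac1{1+\rho}}\le\frac1k\left(q_1^{\frac1{1+\rho}}+\dots+q_k^{\frac1{1+\rho}}\right),\qquad k=1,\dots,M'-1 .$$ Put $\overline{c}=\min\{\overline{c}_X(\rho),\overline{c}_X(1+\rho)\}$, where $\overline{c}_X(\cdot)$ denotes the balancing cost. Then: (i) if $\rho\in(0,1)$, $$\mathbb{E}[C_{\mathcal{G}}(X)^\rho]\le\frac{1}{\overline{c}(1+\rho)}\left[\sum_{k=1}^{M'}q_k^{\frac1{1+\rho}}\right]^{1+\rho}+\frac{\rho\,\overline{c}^{\,\rho}}{1+\rho}P\left(\overline{c}\le C_{\mathcal{G}}(X)<\overline{c}+1\right)+\left((\overline{c}+1)^\rho-\frac{(\overline{c}+1)^{1+\rho}-1}{\overline{c}(1+\rho)}\right)P\left(C_{\mathcal{G}}(X)\ge\overline{c}+1\right);$$ (ii) if $\rho\in[1,2]$, $$\mathbb{E}[C_{\mathcal{G}}(X)^\rho]\le\frac{1}{1+\rho}\left[\sum_{k=1}^{M'}q_k^{\frac1{1+\rho}}\right]^{1+\rho}+\frac1\rho\left[\sum_{k=1}^{M'}q_k^{\frac1\rho}\right]^{\rho}+\frac{\overline{c}^{\,\rho}\left(\rho^2-\overline{c}\rho-1\right)}{\rho(1+\rho)}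 .$$
   Context: $X$ is a random variable on a finite set $\mathcal{X}$ with $|\mathcal{X}|=M$ and distribution $P_X$; each $x\in\mathcal{X}$ has a fixed real cost $c_x$. A guessing strategy is a bijection $\mathcal{G}:\mathcal{X}\to\{1,\dots,M\}$. For a given $\mathcal{G}$ write $p_i=P_X(\mathcal{G}^{-1}(i))$ and $c_i=c_{\mathcal{G}^{-1}(i)}$. The guessing cost is $C_{\mathcal{G}}(x)=\sum_{j=1}^{\mathcal{G}(x)}c_j$, so $\mathbb{E}[C_{\mathcal{G}}(X)^\rho]=\sum_{i=1}^M p_i\left(\sum_{j=1}^i c_j\right)^\rho$. Induced weights: $q_k=p_i$ for $\sum_{l=1}^{i-1}\lceil c_l\rceil<k\le\sum_{l=1}^{i}\lceil c_l\rceil$, $i=1,\dots,M$. Balancing cost: for $\rho>0$, $\overline{c}_X(\rho)$ is a real number (assumed to exist, with all powers well defined) satisfying $\sum_{i=1}^M\left(\sum_{j=1}^{i-1}c_j\right)^\rho p_i=\sum_{i=1}^M\left(\sum_{j=1}^{i}c_j-\overline{c}_X(\rho)\right)^\rho p_i$ (equal to the common cost if all costs are equal).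
   Formalization: The balancing cost is taken to be the smallest real solution of the balance equation; at order 2 the equation can have two solutions, and with the larger one the stated bound can fail (for example at ρ = 2). *)

(* Defs.v *)
From mathcomp Require Import all_boot all_order all_algebra.
From mathcomp Require Import all_classical reals exp.

Set Implicit Arguments.
Unset Strict Implicit.
Unset Printing Implicit Defensive.

Import Order.TTheory GRing.Theory Num.Theory.
Local Open Scope ring_scope.

(* A bijection between the alphabet and its ranks.  Ranks are 0-based: the rank
   [i : 'I_#|X|] stands for the (i+1)-st guess. *)
Record guessing_strategy (X : finType) := GuessingStrategy {
  rank :> X -> 'I_#|X|;
  unrank : 'I_#|X| -> X;
  rankK : cancel rank unrank;
  unrankK : cancel unrank rank
}.

Section Guessing.
Variables (R : realType) (X : finType).
Implicit Types (P c : X -> R) (G : guessing_strategy X) (i : 'I_#|X|).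

Definition is_distribution P := (forall x, 0 <= P x) /\ \sum_x P x = 1.

Definition prob P (E : pred X) : R := \sum_(x | E x) P x.

Definition expectation P (Y : X -> R) : R := \sum_x P x * Y x.

Definition ranked (f : X -> R) G i : R := f (unrank G i).

Definition cost_upto c G i : R := \sum_(j < #|X| | (j <= i)%N) ranked c G j.

Definition cost_before c G i : R := \sum_(j < #|X| | (j < i)%N) ranked c G j.

Definition guessing_cost c G (x : X) : R := cost_upto c G (G x).

(* The absolute value only casts to [nat]: costs are positive in all uses. *)
Definition ceil_cost c G i : nat := `|Num.ceil (ranked c G i)|%N.

Definition ceil_upto c G i : nat :=
  (\sum_(j < #|X| | (j <= i)%N) ceil_cost c G j)%N.

Definition ceil_before c G i : nat :=
  (\sum_(j < #|X| | (j < i)%N) ceil_cost c G j)%N.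

Definition total_weights c G : nat := (\sum_(i < #|X|) ceil_cost c G i)%N.

(* q_k, for 1 <= k <= total_weights c G (and 0 outside this range). *)
Definition weight P c G (k : nat) : R :=
  if [pick i | (ceil_before c G i < k <= ceil_upto c G i)%N] is Some i
  then ranked P G i else 0.

(* q_(k+1)^(1/r) <= (q_1^(1/r) + ... + q_k^(1/r)) / k *)
Definition mean_dominated (q : nat -> R) (n : nat) (r : R) :=
  forall k : nat, (1 <= k < n)%N ->
    q k.+1 `^ r^-1 <= k%:R^-1 * \sum_(1 <= l < k.+1) q l `^ r^-1.

(* The real power x^r makes sense for x >= 0, where it is [powR], and for every
   x when r is a natural number, where it is the usual monomial; [powR] itself
   has a junk value for x < 0. *)
Definition rpow_defined (x r : R) := 0 <= x \/ exists n : nat, r = n%:R.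

Definition rpow (x r : R) : R :=
  if 0 <= x then x `^ r else x ^+ `|Num.floor r|%N.

Definition balances P c G (r b : R) :=
  (forall i, rpow_defined (cost_upto c G i - b) r) /\
  \sum_(i < #|X|) rpow (cost_before c G i) r * ranked P G i =
  \sum_(i < #|X|) rpow (cost_upto c G i - b) r * ranked P G i.

(* For even r the balance equation can have a second solution, beyond some of
   the cumulated costs (already when all costs are equal); the balancing cost is
   the smallest solution, as the convention for equal costs requires.  That
   convention, the last conjunct, is in fact a consequence of the first two
   whenever r and the common cost are positive. *)
Definition is_balancing_cost P c G (r b : R) :=
  [/\ balances P c G r b,
      forall b', balances P c G r b' -> b <= b' &
      forall a, (forall x, c x = a) -> b = a].

Lemma weightE P c G i (k : nat) :
  (ceil_before c G i < k <= ceil_upto c G i)%N -> weight P c G k = ranked P G i.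
Proof.
have sep (j l : 'I_#|X|) : (j < l)%N -> (ceil_upto c G j <= ceil_before c G l)%N.
  move=> jl; rewrite /ceil_upto /ceil_before [leqLHS]big_mkcond.
  rewrite [leqRHS]big_mkcond; apply: leq_sum => m _.
  by case: (leqP m j) => // mj; rewrite (leq_ltn_trans mj jl).
move=> /andP[ik ki]; rewrite /weight; case: pickP => [j /andP[jk kj]|]; last first.
  by move/(_ i); rewrite ik ki.
have [ij|ji|/val_inj-> //] := ltngtP i j.
- by have := leq_trans (leq_ltn_trans (sep _ _ ij) jk) ki; rewrite ltnn.
- by have := leq_trans (leq_ltn_trans (sep _ _ ji) ik) kj; rewrite ltnn.
Qed.

Lemma rpow_nat (x : R) (n : nat) : rpow x n%:R = x ^+ n.
Proof.
by rewrite /rpow; case: ifP => [x0|_]; rewrite ?powR_mulrn // pmulrn intrKfloor.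
Qed.

End Guessing.

(* Main.v *)
Require Import Defs.
From mathcomp Require Import all_boot all_order all_algebra.
From mathcomp Require Import all_classical reals exp.
From mathcomp Require Import topology normedtype sequences derive realfun.
From mathcomp Require Import ring lra.

Set Implicit Arguments.
Unset Strict Implicit.
Unset Printing Implicit Defensive.

Import Order.TTheory GRing.Theory Num.Theory.
Import numFieldNormedType.Exports.
Local Open Scope ring_scope.

(** The induced weights repeat each probability [p_i] over [ceil c_i] consecutive
ranks.  For [r >= 1], Boztas' argument bounds [sum_k (k^r - (k-1)^r) q_k] by
[(sum_k q_k^(1/r))^r]: the increments of [x^r] are nondecreasing, so dominating
each [q_(k+1)^(1/r)] by the mean of its predecessors makes the bound telescope.
Summing over the block of each symbol and using [c_i <= ceil c_i], the same bound
holds for [E[S^r - T^r]], where [S] and [T] are the costs accumulated with and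
without the last guess; by balancing, it also holds for [E[S^r - (S - b)^r]]
for [b] up to the balancing cost.

It remains to compare [S^rho] with these increments pointwise.  When [rho] is not
an integer, [b <= S] always, and the comparison says that a function of [S] is
monotone on [[b, +oo[], which reduces to Bernoulli's inequality for its
derivative.  When [rho] is 1 or 2, [S - b] may be negative, and one compares the
moments of [S] instead, using that the balancing cost of order 2, being the
smallest root of a quadratic with vertex [E[S]], is at most [E[S]]. *)

(** * Inequalities and monotonicity for real powers *)

Lemma powR_le_affine (R : realType) (y a : R) :
  0 < y -> 0 <= a <= 1 -> y `^ a <= 1 - a + a * y.
Proof.
move=> y0 /andP[a0 a1].
(* With [L = ln y], both inequalities [h1] and [h2] are instances of [1 + u <= exp u];
their combination with weights [1 - a] and [a] cancels [L]. *)
have yaE : y `^ a = expR (a * ln y) by rewrite /powR gt_eqF.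
have h1 : y `^ a * (1 - a * ln y) <= 1.
  rewrite -[leRHS](expRxMexpNx_1 (a * ln y)) -yaE ler_wpM2l ?powR_ge0//.
  exact: expR_ge1Dx.
have h2 : y `^ a * (1 + (1 - a) * ln y) <= y.
  have yE : y = y `^ a * expR ((1 - a) * ln y).
    by rewrite yaE -expRD mulrBl mul1r addrC subrK lnK.
  by rewrite [leRHS]yE ler_wpM2l ?powR_ge0// expR_ge1Dx.
have a1' : 0 <= 1 - a by lra.
have := lerD (ler_wpM2l a1' h1) (ler_wpM2l a0 h2).
lra.
Qed.

(** Provides continuity at the left end point of [[b, +oo[], where the base [t - b] vanishes and the
    derivative rule for positive bases does not apply. *)
Lemma cvg_powR_subr (R : realType) (b r : R) : 0 < r ->
  ((t - b) `^ r @[t --> b^'+] --> (0 : R))%classic.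
Proof.
move=> r0; apply/cvgr0Pnorm_lt => e e0; near=> t.
have tb : b < t by near: t; exact: nbhs_right_gt.
(* Writing [e] as the [r]-th power of [e^(1/r)] reduces the goal to [t - b < e^(1/r)]. *)
rewrite ger0_norm ?powR_ge0// -[ltRHS](@powRr1 _ e) ?ltW//.
rewrite -(mulVf (lt0r_neq0 r0)) powRrM.
rewrite gt0_ltr_powR ?nnegrE ?powR_ge0 ?subr_ge0 ?(ltW tb)//.
rewrite ltrBlDl; near: t; apply: nbhs_right_lt.
by rewrite ltrDl powR_gt0.
Unshelve. all: end_near. Qed.

(** The hypothesis is the sign of [F'] on []b, +oo[]. The free coefficients let one differentiation
    serve the convexity of powers and both ranges of [rho]. *)
Lemma powR_comb_nondecreasing (R : realType) (b r s al ga de : R) :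
  0 < b -> 0 < r -> 0 < s ->
  (forall t, b < t -> 0 <= al * (r * (t `^ (r - 1) - (t - b) `^ (r - 1)))
                           + s * (ga * t `^ (s - 1) - de * (t - b) `^ (s - 1))) ->
  let F t := al * (t `^ r - (t - b) `^ r) + (ga * t `^ s - de * (t - b) `^ s) in
  forall x y, b <= x -> x <= y -> F x <= F y.
Proof.
move=> b0 r0 s0 dF F.
have dsub u t : b < t ->
    is_derive t 1 ((@powR R ^~ u) \o (fun x => x - b)) (u * (t - b) `^ (u - 1) * 1).
  move=> bt; apply: is_derive1_comp; first by apply: is_derive1_powR; rewrite subr_gt0.
  rewrite -[1 in X in is_derive _ _ _ X]subr0.
  exact: (is_deriveB (is_derive_id _ _) (is_derive_cst _ _ _)).
have FE : F = al \*: ((@powR R ^~ r) - ((@powR R ^~ r) \o (fun x => x - b)))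
  + (ga \*: (@powR R ^~ s) - de \*: ((@powR R ^~ s) \o (fun x => x - b))) by [].
have dF1 t : b < t -> is_derive t 1 F
    (al * (r * (t `^ (r - 1) - (t - b) `^ (r - 1)))
     + s * (ga * t `^ (s - 1) - de * (t - b) `^ (s - 1))).
  move=> bt; have t0 := lt_trans b0 bt; rewrite FE.
  have d1 := @is_derive1_powR R r _ t0; have d2 := @is_derive1_powR R s _ t0.
  have dF2 := (is_deriveD (is_deriveZ al (is_deriveB d1 (dsub r t bt)))
    (is_deriveB (is_deriveZ ga d2) (is_deriveZ de (dsub s t bt)))).
  apply: (is_derive_eq dF2).
  rewrite /GRing.scale /=; ring.
apply: ger0_derive1_ndecry.
- by move=> x /[!in_itv]/= /[!andbT] /dF1[].
- move=> x /[!in_itv]/= /[!andbT] bx.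
  by rewrite derive1E (@derive_val _ _ _ _ _ _ _ (dF1 _ bx)) dF.
- apply/continuous_within_itvcyP; split.
    move=> x /[!in_itv]/= /[!andbT] /dF1[dx _].
    by apply: differentiable_continuous; exact/derivable1_diffP.
  have cb u : (t `^ u @[t --> b^'+] --> b `^ u)%classic.
    apply: (@cvg_at_right_filter _ _ (@powR R ^~ u)).
    have [db _] := @is_derive1_powR R u _ b0.
    move/derivable1_diffP : db => /differentiable_continuous; apply.
  rewrite /F subrr !powR0 ?lt0r_neq0//.
  apply: cvgD; first by apply: cvgMl_tmp; apply: cvgB => //; exact: cvg_powR_subr.
  by apply: cvgB; apply: cvgMl_tmp => //; exact: cvg_powR_subr.
Qed.

(** Enlarging [h] to [k] only raises the first power at [y]. For equal lengths, [t^r - (t - h)^r] is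
    nondecreasing in [t] because [t^(r - 1)] is. *)
Lemma powR_increment_le (R : realType) (r x y h k : R) :
  1 <= r -> 0 <= x <= y -> 0 <= h <= k ->
  (x + h) `^ r - x `^ r <= (y + k) `^ r - y `^ r.
Proof.
move=> r1 /andP[x0 xy] /andP[h0 hk].
have y0 := le_trans x0 xy.
apply: (@le_trans _ _ ((y + h) `^ r - y `^ r)); last first.
  by rewrite lerB// ge0_ler_powR ?nnegrE ?addr_ge0 ?lerD2l//; lra.
move: h0; rewrite le_eqVlt => /predU1P[<-|h0]; first by rewrite !addr0 !subrr.
have := @powR_comb_nondecreasing R h r 1 1 0 0 h0 _ ltr01.
rewrite /= => /(_ _ _ (x + h) (y + h)).
rewrite !mul0r !subrr !addr0 !mul1r !addrK; apply; try lra.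
move=> t ht; rewrite !mul0r subrr mulr0 addr0 mul1r mulr_ge0//; first by lra.
by rewrite subr_ge0 ge0_ler_powR ?nnegrE; lra.
Qed.

(** Induction on [n]. With [A] the sum so far and [a] the next root, the new term equals
    [(n a + a)^r - (n a)^r]. Since [n a <= A], it is at most [(A + a)^r - A^r]. *)
Lemma sum_powR_increment_le (R : realType) (q : nat -> R) (n : nat) (r : R) :
  1 <= r -> (forall k, 0 <= q k) -> mean_dominated q n r ->
  \sum_(0 <= k < n) (k.+1%:R `^ r - k%:R `^ r) * q k.+1 <=
    (\sum_(1 <= k < n.+1) q k `^ r^-1) `^ r.
Proof.
move=> r1 q0; elim: n => [|n IHn] hq; first by rewrite big_nil powR_ge0.
have r0 : 0 < r by lra.
have qK : q n.+1 = (q n.+1 `^ r^-1) `^ r by rewrite -powRrM mulVf ?gt_eqF ?powRr1.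
rewrite big_nat_recr //= [in leRHS]big_nat_recr //=.
set A := \sum_(1 <= k < n.+1) _; set a := q n.+1 `^ r^-1.
have a0 : 0 <= a by exact: powR_ge0.
have nA : n%:R * a <= A.
  (* Mean domination starts at [k = 1]; for [n = 0] the left side is simply zero. *)
  case: n @A @a hq {IHn qK a0} => [|n] A a hq.
    by rewrite mul0r sumr_ge0// => *; exact: powR_ge0.
  by rewrite mulrC -ler_pdivlMr// mulrC hq /=.
have {}IHn : \sum_(0 <= k < n) (k.+1%:R `^ r - k%:R `^ r) * q k.+1 <= A `^ r.
  by apply: IHn => k /andP[k1 kn]; rewrite hq// k1 ltnW.
rewrite -lerBrDl; apply: (@le_trans _ _ ((A + a) `^ r - A `^ r)); last by rewrite lerB.
rewrite qK -/a mulrBl -!powRM// -[n.+1]addn1 natrD mulrDl mul1r.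
by apply: powR_increment_le; rewrite ?nA ?mulr_ge0 ?a0 ?lexx.
Qed.

Lemma big_ord_leq (V : Type) (idx : V) (op : Monoid.com_law idx) (n : nat) (i : 'I_n)
    (F : 'I_n -> V) :
  \big[op/idx]_(j < n | (j <= i)%N) F j = op (\big[op/idx]_(j < n | (j < i)%N) F j) (F i).
Proof.
rewrite (bigD1 i)//= Monoid.mulmC; congr (op _ _).
by apply: eq_bigl => j; rewrite ltn_neqAle andbC.
Qed.

Lemma powRS (R : realType) (t a : R) : 0 < t -> t `^ (a + 1) = t * t `^ a.
Proof.
move=> t0; rewrite powRD ?powRr1 1?mulrC ?(ltW t0)//.
by rewrite (gt_eqF t0) implybT.
Qed.

(** Bernoulli's inequality [powR_le_affine] at [(t - b) / t], rescaled by [t^a]. *)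
Lemma powR_subr_le (R : realType) (t b a : R) : 0 <= b < t -> 0 <= a <= 1 ->
  (t - b) `^ a <= (t - a * b) * t `^ (a - 1).
Proof.
move=> /andP[b0 bt] a01; have t0 : 0 < t := le_lt_trans b0 bt.
have y0 : 0 < (t - b) / t by rewrite divr_gt0// subr_gt0.
have tbE : t - b = t * ((t - b) / t) by rewrite mulrC divfK ?gt_eqF.
have taE : t `^ a = t * t `^ (a - 1) by rewrite -powRS// subrK.
rewrite tbE powRM; [|exact: ltW..].
rewrite taE [leLHS]mulrAC ler_wpM2r ?powR_ge0//.
apply: (le_trans (ler_wpM2l (ltW t0) (powR_le_affine y0 a01))).
by rewrite le_eqVlt; apply/orP; left; apply/eqP; field; rewrite gt_eqF.
Qed.

(** The derivative of [f] is nonpositive exactly when [(t - b)^rho <= t^rho - rho b t^(rho - 1)],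
    which is [powR_subr_le] with [a = rho]. *)
Lemma powR_comb_decreasing01 (R : realType) (rho b : R) : 0 < rho < 1 -> 0 < b ->
  let f t := t `^ rho - (t `^ (1 + rho) - (t - b) `^ (1 + rho)) / (b * (1 + rho)) in
  forall x y, b <= x -> x <= y -> f y <= f x.
Proof.
move=> /andP[rho0 rho1] b0 f x y bx xy.
have r0 : 0 < 1 + rho by lra.
have fE t : f t = - ((b * (1 + rho))^-1 * (t `^ (1 + rho) - (t - b) `^ (1 + rho))
    + (-1 * t `^ rho - 0 * (t - b) `^ rho)) by rewrite /f; ring.
rewrite !fE lerN2; apply: powR_comb_nondecreasing => // t bt.
have t0 := lt_trans b0 bt.
rewrite mul0r subr0 [1 + rho - 1]addrAC subrr add0r.
have := @powR_subr_le R t b rho; rewrite bt ltW// => /(_ isT).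
rewrite (ltW rho0) (ltW rho1) => /(_ isT) hle.
have tE : t `^ rho = t * t `^ (rho - 1) by rewrite -powRS// subrK.
rewrite mulN1r mulrN subr_ge0 invfM mulrA -(mulrA b^-1) mulVf ?gt_eqF// mulr1.
rewrite ler_pdivlMl// tE; lra.
Qed.

Lemma powR_comb_nondecreasing12 (R : realType) (rho b : R) : 1 < rho < 2 -> 1 <= b ->
  let f t := (1 + rho)^-1 * (t `^ (1 + rho) - (t - b) `^ (1 + rho))
    + rho^-1 * (t `^ rho - (t - b) `^ rho) - t `^ rho in
  forall x y, b <= x -> x <= y -> f x <= f y.
Proof.
move=> /andP[rho1 rho2] b1 f x y bx xy.
have r0 : 0 < 1 + rho by lra.
have rho0 : 0 < rho by lra.
have b0 : 0 < b by lra.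
have fE t : f t = (1 + rho)^-1 * (t `^ (1 + rho) - (t - b) `^ (1 + rho))
    + ((rho^-1 - 1) * t `^ rho - rho^-1 * (t - b) `^ rho) by rewrite /f; ring.
rewrite !fE; apply: powR_comb_nondecreasing => // t bt.
have t0 := lt_trans b0 bt; have tb : 0 < t - b by rewrite subr_gt0.
rewrite [1 + rho - 1]addrAC subrr add0r mulKf ?gt_eqF//.
rewrite mulrBr !mulrA mulrBr mulfV ?gt_eqF// mulr1 mul1r.
have := @powR_subr_le R t b (rho - 1); rewrite bt ltW// => /(_ isT).
have -> : 0 <= rho - 1 <= 1 by apply/andP; split; lra.
move=> /(_ isT).
have tE : t `^ rho = t * t `^ (rho - 1) by rewrite -powRS// subrK.
have tbE : (t - b) `^ rho = (t - b) * (t - b) `^ (rho - 1) by rewrite -powRS// subrK.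
have tE' : t `^ (rho - 1) = t * t `^ (rho - 1 - 1) by rewrite -powRS// subrK.
rewrite tbE tE tE'.
(* The derivative now reads [w (t^2 - a t) - z (t - b + 1)], and [zw] is Bernoulli's bound at the
   exponent [rho - 1]. *)
set z := (t - b) `^ _; set w := t `^ _; set a := rho - 1 => zw.
have w0 : 0 <= w by exact: powR_ge0.
have h1 : z * (t - b + 1) <= (t - a * b) * w * (t - b + 1) by rewrite ler_wpM2r//; lra.
(* By [h1], the quantity to be shown nonnegative is at least [w] times
[t^2 - a t - (t - a b) (t - b + 1)], which is
[(b - 1) (t + a (t - b))]. *)
have h2 : 0 <= (b - 1) * (t + a * (t - b)) * w.
  rewrite mulr_ge0// mulr_ge0 ?subr_ge0// addr_ge0 ?(ltW t0)// mulr_ge0 ?(ltW tb)//.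
  by rewrite subr_ge0 ltW.
rewrite /a in h1 h2 *; nra.
Qed.

(** The coefficients of the two indicators are the values at [b] and at [b + 1] of the function in
    [powR_comb_decreasing01]; each bounds it to the right of that point. *)
Lemma powR_le_increment01 (R : realType) (rho b s : R) : 0 < rho < 1 -> 0 < b <= s ->
  s `^ rho <= (b * (1 + rho))^-1 * (s `^ (1 + rho) - (s - b) `^ (1 + rho))
    + rho * b `^ rho / (1 + rho) * (b <= s < b + 1)%R%:R
    + ((b + 1) `^ rho - ((b + 1) `^ (1 + rho) - 1) / (b * (1 + rho))) * (b + 1 <= s)%R%:R.
Proof.
move=> rho01 /andP[b0 bs]; have [rho0 rho1] := andP rho01.
have f_le := powR_comb_decreasing01 rho01 b0.
rewrite bs /=; have [b1s|sb1] := leP (b + 1) s.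
  have := f_le (b + 1) s; rewrite /= [b + 1 - b]addrAC subrr add0r powR1.
  by move=> /(_ _ b1s); rewrite lerDl ler01 => /(_ isT); lra.
have := f_le b s (lexx _) bs; rewrite /= subrr powR0 ?subr0; last by rewrite gt_eqF; lra.
have -> : b `^ (1 + rho) = b * b `^ rho by rewrite addrC powRS.
have -> : b `^ rho - b * b `^ rho / (b * (1 + rho)) = rho * b `^ rho / (1 + rho).
  by field; rewrite !gt_eqF; lra.
lra.
Qed.

(** The constant is minus the value at [b] of the function in [powR_comb_nondecreasing12]. *)
Lemma powR_le_increments12 (R : realType) (rho b s : R) : 1 < rho < 2 -> 1 <= b <= s ->
  s `^ rho <= (1 + rho)^-1 * (s `^ (1 + rho) - (s - b) `^ (1 + rho))
    + rho^-1 * (s `^ rho - (s - b) `^ rho)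
    + b `^ rho * (rho ^+ 2 - b * rho - 1) / (rho * (1 + rho)).
Proof.
move=> rho12 /andP[b1 bs]; have [rho1 rho2] := andP rho12.
have := powR_comb_nondecreasing12 rho12 b1 (lexx b) bs.
rewrite /= subrr !powR0; [|by rewrite gt_eqF; lra..].
have -> : b `^ (1 + rho) = b * b `^ rho by rewrite addrC powRS//; lra.
have -> : (1 + rho)^-1 * (b * b `^ rho - 0) + rho^-1 * (b `^ rho - 0) - b `^ rho =
    - (b `^ rho * (rho ^+ 2 - b * rho - 1) / (rho * (1 + rho))).
  by field; rewrite !gt_eqF; lra.
lra.
Qed.

Lemma natr_gap_neq (R : realType) (x : R) (n m : nat) :
  n%:R < x < n.+1%:R -> x <> m%:R.
Proof.
by move=> /[swap] ->; rewrite !ltr_nat ltnS => /andP[nm /(leq_trans nm)]; rewrite ltnn.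
Qed.

(** * Costs, weights and balancing along the guessing order *)

Section Guessing.
Variables (R : realType) (X : finType) (P c : X -> R) (G : guessing_strategy X).

Lemma cost_uptoE i : cost_upto c G i = cost_before c G i + ranked c G i.
Proof. exact: big_ord_leq. Qed.

Lemma ceil_uptoE i : ceil_upto c G i = (ceil_before c G i + ceil_cost c G i)%N.
Proof. exact: big_ord_leq. Qed.

Lemma expectation_ranked (f : R -> R) :
  expectation P (fun x => f (guessing_cost c G x)) =
  \sum_i f (cost_upto c G i) * ranked P G i.
Proof.
rewrite /expectation (reindex (unrank G)); last first.
  by exists G => x _; rewrite ?rankK ?unrankK.
by apply: eq_bigr => i _; rewrite /guessing_cost unrankK mulrC.
Qed.

Lemma prob_expectation (E : pred X) : prob P E = expectation P (fun x => (E x)%:R).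
Proof.
rewrite /prob /expectation big_mkcond; apply: eq_bigr => x _.
by case: (E x); rewrite ?mulr1 ?mulr0.
Qed.

(** On the block of rank [i] all weights equal [p_i], so the increments of [f] telescope across
    it. *)
Lemma sum_weight (f : nat -> R) :
  \sum_(0 <= k < total_weights c G) (f k.+1 - f k) * weight P c G k.+1 =
  \sum_i (f (ceil_upto c G i) - f (ceil_before c G i)) * ranked P G i.
Proof.
(* [N m] is where the first [m] blocks end; at a rank [i] it is [ceil_before c G i] by
   conversion. *)
pose N m := (\sum_(j < #|X| | (j < m)%N) ceil_cost c G j)%N.
suff IH m : (m <= #|X|)%N -> \sum_(0 <= k < N m) (f k.+1 - f k) * weight P c G k.+1 =
    \sum_(i < #|X| | (i < m)%N)
      (f (ceil_upto c G i) - f (ceil_before c G i)) * ranked P G i.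
  have -> : total_weights c G = N #|X| by apply: eq_bigl => j; rewrite ltn_ord.
  by rewrite IH//; apply: eq_bigl => j; rewrite ltn_ord.
elim: m => [|m IHm] mX.
  have -> : N 0 = 0%N by rewrite /N big_pred0.
  by rewrite big_nil big_pred0.
pose i := Ordinal mX.
have NS : N m.+1 = (N m + ceil_cost c G i)%N by exact: ceil_uptoE i.
rewrite (@big_cat_nat _ _ _ (N m))//= ?NS ?leq_addr// IHm 1?ltnW//.
rewrite [RHS](big_ord_leq _ i) /=; congr (_ + _).
rewrite -/(ceil_upto c G i) ceil_uptoE -[ceil_before c G i]/(N m).
rewrite -(telescope_sumr _ (leq_addr _ _)) big_distrl /=.
apply: eq_big_nat => k /andP[mk km]; rewrite (@weightE _ _ _ _ _ i)//.
by rewrite ceil_uptoE -[ceil_before c G i]/(N m) ltnS mk km.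
Qed.

Hypothesis hc : forall x, 1 < c x.

Lemma ranked_cost_gt1 i : 1 < ranked c G i. Proof. exact: hc. Qed.

Lemma cost_before_ge0 i : 0 <= cost_before c G i.
Proof.
by apply: sumr_ge0 => j _; rewrite ltW// (lt_trans ltr01 (ranked_cost_gt1 j)).
Qed.

Lemma cost_upto_ge0 i : 0 <= cost_upto c G i.
Proof.
by apply: sumr_ge0 => j _; rewrite ltW// (lt_trans ltr01 (ranked_cost_gt1 j)).
Qed.

Lemma le_ceil_cost i : ranked c G i <= (ceil_cost c G i)%:R.
Proof.
rewrite /ceil_cost; apply: (le_trans (Num.Theory.ceil_ge _)).
by rewrite natr_absz ler_int ler_norm.
Qed.

Lemma cost_before_le_ceil i : cost_before c G i <= (ceil_before c G i)%:R.
Proof. by rewrite /ceil_before natr_sum; apply: ler_sum => j _; exact: le_ceil_cost. Qed.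

Hypothesis hP : is_distribution P.

Lemma ranked_ge0 i : 0 <= ranked P G i. Proof. by have [P0 _] := hP; exact: P0. Qed.

Lemma weight_ge0 k : 0 <= weight P c G k.
Proof. by rewrite /weight; case: pickP => // i _; exact: ranked_ge0. Qed.

Lemma sum_ranked : \sum_i ranked P G i = 1.
Proof.
case: hP => _ <-; rewrite (reindex (unrank G))//=.
by exists G => x _; rewrite ?rankK ?unrankK.
Qed.

(** Rounding costs up moves each interval from [cost_before] to [cost_upto] to the right and
    lengthens it, which by convexity can only enlarge the increment of the [r]-th power. *)
Lemma cost_increments_le r : 1 <= r ->
  mean_dominated (weight P c G) (total_weights c G) r ->
  \sum_i (cost_upto c G i `^ r - cost_before c G i `^ r) * ranked P G i <=
  (\sum_(1 <= k < (total_weights c G).+1) weight P c G k `^ r^-1) `^ r.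
Proof.
move=> r1 hq; apply: le_trans (sum_powR_increment_le r1 weight_ge0 hq).
rewrite (sum_weight (fun k => k%:R `^ r)); apply: ler_sum => i _.
rewrite ler_wpM2r ?ranked_ge0// cost_uptoE ceil_uptoE natrD.
apply: powR_increment_le => //; first by rewrite cost_before_ge0 cost_before_le_ceil.
by rewrite le_ceil_cost ltW// (lt_trans ltr01 (ranked_cost_gt1 i)).
Qed.

Let S := cost_upto c G.
Let p := ranked P G.
Let increments r := \sum_i (S i `^ r - cost_before c G i `^ r) * p i.

(** If [b < 1], then each [S - b] exceeds the preceding cost, as every cost is above 1. The balance
    equation then forces all probabilities to vanish. *)
Lemma balances_ge1 r b : 0 < r -> balances P c G r b -> 1 <= b.
Proof.
move=> r0 [_ bal]; rewrite leNgt; apply/negP => b1.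
pose d i := rpow (S i - b) r - rpow (cost_before c G i) r.
have d0 i : 0 < d i.
  have T0 := cost_before_ge0 i; have c1 := ranked_cost_gt1 i.
  have S0 : cost_before c G i < S i - b by rewrite /S cost_uptoE; lra.
  rewrite /d /rpow T0 (ltW (le_lt_trans T0 S0)) subr_gt0 gt0_ltr_powR ?nnegrE//.
  exact: ltW (le_lt_trans T0 S0).
have : \sum_i d i * p i = 0.
  rewrite /d; under eq_bigr do rewrite mulrBl.
  by rewrite sumrB bal subrr.
move=> /psumr_eq0P => dp0.
have p0 i : p i = 0.
  have /eqP := dp0 (fun i _ => mulr_ge0 (ltW (d0 i)) (ranked_ge0 i)) i isT.
  by rewrite mulf_eq0 gt_eqF//= => /eqP.
have := sum_ranked; rewrite (eq_bigr _ (fun i _ => p0 i)) big1_eq => /eqP.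
by rewrite eq_sym oner_eq0.
Qed.

Lemma increments_balances_nat (r b : R) n : r = n%:R -> balances P c G r b ->
  increments r = \sum_i (S i ^+ n - (S i - b) ^+ n) * p i.
Proof.
move=> -> [_ bal].
under [RHS]eq_bigr do rewrite mulrBl -(rpow_nat (_ - _)).
rewrite sumrB -bal -sumrB; apply: eq_bigr => i _.
by rewrite -mulrBl rpow_nat !powR_mulrn ?cost_before_ge0 ?cost_upto_ge0.
Qed.

(** A power of non-natural order is only defined on a nonnegative base. *)
Lemma balances_le_cost r b i : (forall n : nat, r <> n%:R) ->
  balances P c G r b -> b <= S i.
Proof.
by move=> rn [def _]; have [|[n /rn]] := def i; rewrite ?subr_ge0.
Qed.

(** Equality holds at [b0] by balancing; lowering [b0] to [b] raises the subtracted power, whose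
    base stays nonnegative. *)
Lemma increments_balances_ge r b0 b : 0 < r -> (forall n : nat, r <> n%:R) ->
  balances P c G r b0 -> b <= b0 ->
  \sum_i (S i `^ r - (S i - b) `^ r) * p i <= increments r.
Proof.
move=> r0 rn bal bb0; have b0S i := balances_le_cost i rn bal.
suff -> : increments r = \sum_i (S i `^ r - (S i - b0) `^ r) * p i.
  apply: ler_sum => i _; rewrite ler_wpM2r ?ranked_ge0// lerB//.
  have b0Si := b0S i.
  by rewrite ge0_ler_powR ?nnegrE ?(ltW r0)//; lra.
rewrite /increments; under eq_bigr do rewrite mulrBl.
under [RHS]eq_bigr do rewrite mulrBl.
rewrite !sumrB; congr (_ - _); case: bal => _.
rewrite /rpow; under eq_bigr do rewrite cost_before_ge0.
by under [RHS]eq_bigr do rewrite subr_ge0 b0S.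
Qed.

Lemma balancing_cost2_le_mean b :
  is_balancing_cost P c G 2 b -> b <= \sum_i S i * p i.
Proof.
move=> [[_ bal] bmin _]; set m := \sum_i _.
(* [2 m - b] is the other root of the quadratic balance equation. *)
suff /bmin : balances P c G 2 (2 * m - b) by lra.
split=> [i|]; first by right; exists 2%N.
rewrite bal; under eq_bigr do rewrite rpow_nat.
under [RHS]eq_bigr do rewrite rpow_nat.
apply/eqP; rewrite -subr_eq0 -sumrB.
(* Termwise, the two sides of the balance differ by [4 (m - b) (S i - m) p i], and deviations from
   the mean sum to zero. *)
have z0 : \sum_i (4 * (m - b) * (S i * p i) - 4 * (m - b) * m * p i) = 0.
  by rewrite sumrB -!mulr_sumr sum_ranked mulr1 subrr.
by apply/eqP; rewrite -[RHS]z0; apply: eq_bigr => i _; rewrite -/(S i) -/(p i); ring.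
Qed.

(** The quasi-norm of the weights in [l^(1/r)]. *)
Let weight_norm (r : R) :=
  (\sum_(1 <= k < (total_weights c G).+1) weight P c G k `^ r^-1) `^ r.
Let weights_dominated (r : R) := mean_dominated (weight P c G) (total_weights c G) r.

Lemma balances_nat_le (r b : R) (n : nat) : r = n%:R -> (0 < n)%N ->
  weights_dominated r -> balances P c G r b ->
  \sum_i (S i ^+ n - (S i - b) ^+ n) * p i <= weight_norm r.
Proof.
move=> rn n0 hq bal; rewrite -(increments_balances_nat rn bal).
by apply: cost_increments_le => //; rewrite rn ler1n.
Qed.

Lemma balances_nonnat_le (r b0 b : R) : 1 < r -> (forall n : nat, r <> n%:R) ->
  weights_dominated r -> balances P c G r b0 -> b <= b0 ->
  \sum_i (S i `^ r - (S i - b) `^ r) * p i <= weight_norm r.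
Proof.
move=> r1 rn hq bal bb0.
apply: le_trans (cost_increments_le (ltW r1) hq).
by apply: increments_balances_ge bal bb0 => //; lra.
Qed.

(** * Non-integer exponents, by averaging the pointwise comparisons *)

Lemma guessing_cost_bound01 (rho b2 b : R) : 0 < rho < 1 ->
  weights_dominated (1 + rho) -> balances P c G (1 + rho) b2 -> 1 <= b -> b <= b2 ->
  expectation P (fun x => guessing_cost c G x `^ rho) <=
    (b * (1 + rho))^-1 * weight_norm (1 + rho)
    + rho * b `^ rho / (1 + rho) * prob P (fun x => b <= guessing_cost c G x < b + 1)
    + ((b + 1) `^ rho - ((b + 1) `^ (1 + rho) - 1) / (b * (1 + rho)))
      * prob P (fun x => b + 1 <= guessing_cost c G x).
Proof.
move=> rho01 hq bal2 b_ge1 bb2; have [rho0 rho1] := andP rho01.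
have rN n : 1 + rho <> n%:R by apply: (@natr_gap_neq _ _ 1); apply/andP; split; lra.
have bS i : b <= S i := le_trans bb2 (balances_le_cost i rN bal2).
have r1 : 1 < 1 + rho by lra.
have := balances_nonnat_le r1 rN hq bal2 bb2.
have k0 : 0 <= (b * (1 + rho))^-1 by rewrite invr_ge0 mulr_ge0; lra.
move=> /(ler_wpM2l k0) hS.
rewrite !prob_expectation (expectation_ranked (fun s => s `^ rho)).
rewrite (expectation_ranked (fun s => (b <= s < b + 1)%R%:R)).
rewrite (expectation_ranked (fun s => (b + 1 <= s)%R%:R)).
apply: (le_trans _ (lerD (lerD hS (lexx _)) (lexx _))).
rewrite !mulr_sumr -!big_split /=; apply: ler_sum => i _.
rewrite !mulrA -!mulrDl ler_wpM2r ?ranked_ge0//.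
by apply: powR_le_increment01 => //; rewrite bS andbT; lra.
Qed.

Lemma guessing_cost_bound12 (rho b1 b2 b : R) : 1 < rho < 2 ->
  weights_dominated rho -> weights_dominated (1 + rho) ->
  balances P c G rho b1 -> balances P c G (1 + rho) b2 ->
  1 <= b -> b <= b1 -> b <= b2 ->
  expectation P (fun x => guessing_cost c G x `^ rho) <=
    (1 + rho)^-1 * weight_norm (1 + rho) + rho^-1 * weight_norm rho
    + b `^ rho * (rho ^+ 2 - b * rho - 1) / (rho * (1 + rho)).
Proof.
move=> rho12 hq1 hq2 bal1 bal2 b_ge1 bb1 bb2; have [rho1 rho2] := andP rho12.
have rho0 : 0 < rho by lra.
have rN1 n : rho <> n%:R by apply: (@natr_gap_neq _ _ 1); apply/andP; split; lra.
have rN2 n : 1 + rho <> n%:R by apply: (@natr_gap_neq _ _ 2); apply/andP; split; lra.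
have bS i : b <= S i := le_trans bb2 (balances_le_cost i rN2 bal2).
have r1 : 1 < 1 + rho by lra.
have k1 : 0 <= rho^-1 by rewrite invr_ge0; lra.
have k2 : 0 <= (1 + rho)^-1 by rewrite invr_ge0; lra.
have /(ler_wpM2l k1) hS1 := balances_nonnat_le rho1 rN1 hq1 bal1 bb1.
have /(ler_wpM2l k2) hS2 := balances_nonnat_le r1 rN2 hq2 bal2 bb2.
rewrite (expectation_ranked (fun s => s `^ rho)).
set K := b `^ rho * _ / _.
have -> : K = \sum_i K * p i by rewrite -mulr_sumr sum_ranked mulr1.
apply: (le_trans _ (lerD (lerD hS2 hS1) (lexx _))).
rewrite !mulr_sumr -!big_split /=; apply: ler_sum => i _.
rewrite !mulrA -!mulrDl ler_wpM2r ?ranked_ge0//.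
by apply: powR_le_increments12 => //; rewrite b_ge1 bS.
Qed.

(** * Exponents 1 and 2, through the moments of the accumulated cost *)

Let mean := \sum_i S i * p i.
Let mean2 := \sum_i S i ^+ 2 * p i.

Lemma sum_sq_increment (b : R) :
  \sum_i (S i ^+ 2 - (S i - b) ^+ 2) * p i = 2 * b * mean - b ^+ 2.
Proof.
have -> : b ^+ 2 = \sum_i b ^+ 2 * p i by rewrite -mulr_sumr sum_ranked mulr1.
by rewrite mulr_sumr -sumrB; apply: eq_bigr => i _; ring.
Qed.

Lemma sum_cube_increment (b : R) :
  \sum_i (S i ^+ 3 - (S i - b) ^+ 3) * p i = 3 * b * mean2 - 3 * b ^+ 2 * mean + b ^+ 3.
Proof.
have -> : b ^+ 3 = \sum_i b ^+ 3 * p i by rewrite -mulr_sumr sum_ranked mulr1.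
by rewrite !mulr_sumr -sumrB -big_split; apply: eq_bigr => i _ /=; ring.
Qed.

Lemma sqr_mean_le : mean ^+ 2 <= mean2.
Proof.
rewrite -subr_ge0; have -> : mean2 - mean ^+ 2 = \sum_i (S i - mean) ^+ 2 * p i.
  have -> : mean2 - mean ^+ 2 = mean2 - (2 * mean) * mean + mean ^+ 2 by ring.
  have -> : mean ^+ 2 = \sum_i mean ^+ 2 * p i.
    by rewrite -mulr_sumr sum_ranked mulr1.
  rewrite {2}/mean /mean2 mulr_sumr -sumrB -big_split; apply: eq_bigr => i _ /=; ring.
by apply: sumr_ge0 => i _; rewrite mulr_ge0 ?sqr_ge0 ?ranked_ge0.
Qed.

Lemma guessing_cost_bound1 (b1 b2 b : R) : weights_dominated 1 -> weights_dominated 2 ->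
  is_balancing_cost P c G 1 b1 -> is_balancing_cost P c G 2 b2 ->
  1 <= b -> b <= b1 -> b <= b2 ->
  expectation P (fun x => guessing_cost c G x `^ 1) <=
    2^-1 * weight_norm 2 + 1^-1 * weight_norm 1 + b `^ 1 * (1 ^+ 2 - b * 1 - 1) / (1 * 2).
Proof.
move=> hq1 hq2 hb1 hb2 b_ge1 bb1 bb2; have [bal1 _ _] := hb1; have [bal2 _ _] := hb2.
have b2m : b2 <= mean := balancing_cost2_le_mean hb2.
have := @balances_nat_le 2 b2 2 erefl isT hq2 bal2; rewrite sum_sq_increment => h2.
have := @balances_nat_le 1 b1 1 erefl isT hq1 bal1.
under eq_bigr do rewrite !expr1 subKr.
rewrite -mulr_sumr sum_ranked mulr1 => h1.
rewrite (expectation_ranked (fun s => s `^ 1)).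
under eq_bigr do rewrite powRr1 ?cost_upto_ge0//.
rewrite -/mean powRr1 ?(le_trans ler01)// invr1.
move: b2m h1 h2; move: mean (weight_norm 1) (weight_norm 2) => m N1 N2 b2m h1 h2.
clear -b_ge1 bb1 bb2 b2m h1 h2.
(* As [b <= b2 <= m], [h3] says that [2 x m - x^2] is at least as large at [x = b2] as at [x = b].
   What remains is [m <= b m - b^2 + b], which is [h4]. *)
have h3 : 0 <= (b2 - b) * (2 * m - b - b2) by rewrite mulr_ge0//; lra.
have h4 : 0 <= (b - 1) * (m - b) by rewrite mulr_ge0//; lra.
nra.
Qed.

Lemma guessing_cost_bound2 (b1 b2 b : R) : weights_dominated 2 -> weights_dominated 3 ->
  is_balancing_cost P c G 2 b1 -> is_balancing_cost P c G 3 b2 ->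
  1 <= b -> b <= b1 -> b <= b2 ->
  expectation P (fun x => guessing_cost c G x `^ 2) <=
    3^-1 * weight_norm 3 + 2^-1 * weight_norm 2 + b `^ 2 * (2 ^+ 2 - b * 2 - 1) / (2 * 3).
Proof.
move=> hq1 hq2 hb1 hb2 b_ge1 bb1 bb2; have [bal1 _ _] := hb1; have [bal2 _ _] := hb2.
have b1m : b1 <= mean := balancing_cost2_le_mean hb1.
have := @balances_nat_le 2 b1 2 erefl isT hq1 bal1; rewrite sum_sq_increment => h1.
have := @balances_nat_le 3 b2 3 erefl isT hq2 bal2.
have h2 : \sum_i (S i ^+ 3 - (S i - b) ^+ 3) * p i <=
    \sum_i (S i ^+ 3 - (S i - b2) ^+ 3) * p i.
  apply: ler_sum => i _; rewrite ler_wpM2r ?ranked_ge0// lerB//.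
  set x := S i - b2; set y := S i - b; have xy : 0 <= y - x by rewrite /x /y; lra.
  rewrite -subr_ge0.
  (* Cubing is monotone on the whole line, so [b2] may be lowered to [b] even where [S i - b2] is
     negative. *)
  have -> : y ^+ 3 - x ^+ 3 = (y - x) * (((x + y) ^+ 2 + x ^+ 2 + y ^+ 2) / 2) by field.
  by rewrite mulr_ge0// divr_ge0// !addr_ge0 ?sqr_ge0.
move=> /(le_trans h2); rewrite sum_cube_increment => {}h2.
rewrite (expectation_ranked (fun s => s `^ 2)).
under eq_bigr do rewrite powR_mulrn ?cost_upto_ge0//.
rewrite -/mean2 powR_mulrn ?(le_trans ler01)//.
move: b1m sqr_mean_le h1 h2.
move: mean mean2 (weight_norm 2) (weight_norm 3) => m m2 N2 N3 b1m mm h1 h2.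
clear -b_ge1 bb1 b1m mm h1 h2.
(* Squares are not monotone on the line, so [h3] passes from [b1] to [b] using [b1 <= m]. After
   adding the bounds, [(b - 1) (m2 - b m) >= 0] remains; it follows from [b m <= m^2 <= m2]. *)
have h3 : 0 <= (b1 - b) * (2 * m - b - b1) by rewrite mulr_ge0//; lra.
have h4 : 0 <= m * (m - b) by rewrite mulr_ge0//; lra.
have h5 : 0 <= (b - 1) * (m2 - b * m).
  by rewrite mulr_ge0 ?subr_ge0// (le_trans _ mm)//; lra.
nra.
Qed.

End Guessing.

Theorem theorem3p6 (R : realType) (X : finType) (P c : X -> R) (rho : R)
    (G : guessing_strategy X) (b1 b2 : R)
    (hP : is_distribution P)
    (hrho : 0 < rho <= 2)
    (hc : forall x, 1 < c x)
    (hq1 : mean_dominated (weight P c G) (total_weights c G) rho)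
    (hq2 : mean_dominated (weight P c G) (total_weights c G) (1 + rho))
    (hb1 : is_balancing_cost P c G rho b1)
    (hb2 : is_balancing_cost P c G (1 + rho) b2) :
  let q := weight P c G in
  let M' := total_weights c G in
  let C := guessing_cost c G in
  let b := Num.min b1 b2 in
  (rho < 1 ->
     expectation P (fun x => C x `^ rho) <=
       (b * (1 + rho))^-1
         * (\sum_(1 <= k < M'.+1) q k `^ (1 + rho)^-1) `^ (1 + rho)
       + rho * b `^ rho / (1 + rho) * prob P (fun x => b <= C x < b + 1)
       + ((b + 1) `^ rho - ((b + 1) `^ (1 + rho) - 1) / (b * (1 + rho)))
         * prob P (fun x => b + 1 <= C x)) /\
  (1 <= rho ->
     expectation P (fun x => C x `^ rho) <=
       (1 + rho)^-1 * (\sum_(1 <= k < M'.+1) q k `^ (1 + rho)^-1) `^ (1 + rho)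
       + rho^-1 * (\sum_(1 <= k < M'.+1) q k `^ rho^-1) `^ rho
       + b `^ rho * (rho ^+ 2 - b * rho - 1) / (rho * (1 + rho))).
Proof.
move=> q M' C b; have [bal1 _ _] := hb1; have [bal2 _ _] := hb2.
have [rho0 rho2] := andP hrho.
have b_ge1 : 1 <= b.
  rewrite le_min (balances_ge1 hc hP rho0 bal1) (balances_ge1 hc hP _ bal2)//; lra.
have bb1 : b <= b1 by rewrite ge_min lexx.
have bb2 : b <= b2 by rewrite ge_min lexx orbT.
split=> [rho1|].
  by apply: (guessing_cost_bound01 hc hP _ hq2 bal2) => //; rewrite rho0.
(* At [rho = 1] and [rho = 2] both orders are natural, so balancing does not force [b <= S]; these
   end points go through moments. *)
rewrite le_eqVlt => /predU1P[rhoE|rho1].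
  have r2 : 1 + rho = 2 by rewrite -rhoE.
  move: hb2 hq2; rewrite r2 -rhoE => hb2' hq2'.
  by apply: (guessing_cost_bound1 hc hP _ hq2' _ hb2' b_ge1 bb1 bb2); rewrite rhoE.
move: rho2; rewrite le_eqVlt => /predU1P[rhoE|rho2].
  have r3 : 1 + rho = 3 by rewrite rhoE; ring.
  move: hb1 hq1 hb2 hq2; rewrite r3 rhoE => hb1' hq1' hb2' hq2'.
  exact: (guessing_cost_bound2 hc hP hq1' hq2' hb1' hb2' b_ge1 bb1 bb2).
by apply: (guessing_cost_bound12 hc hP _ hq1 hq2 bal1 bal2) => //; rewrite rho1.
Qed.
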